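(* Let $f:\mathbb{Q}\to\mathbb{Q}$ be a map. Then $$\frac{f(x)-f(y)}{x-y}\in \mathbb{Q}^2 \quad \text{for all } x\neq y \in \mathbb{Q}$$ if and only if there exist $a,b\in\mathbb{Q}$ such that $f(x)=a^2x+b$ for all $x\in\mathbb{Q}$.
   Context: $\mathbb{Q}^2=\{c^2 : c\in\mathbb{Q}\}$ denotes the set of squares of rational numbers (including $0$). *)

(* Defs.v *)
From mathcomp Require Import all_boot all_order all_algebra.

Set Implicit Arguments.
Unset Strict Implicit.
Unset Printing Implicit Defensive.

Import GRing.Theory.
Local Open Scope ring_scope.

Definition rat_square (q : rat) : Prop := exists c : rat, q = c ^+ 2.

(* Main.v *)
(* Rescale so that (f a, f (a + h), ..., f (a + (p - 1) h)) becomes a sequence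
   y_0, ..., y_(p-1) of integers with every (i - j)(y_i - y_j) a square, p an
   odd prime. If the y_i agree modulo p^n, then the classes modulo p^(n+1) are
   homogeneous sets for the relation "i - j is a square" on F_p: for i, j in
   a class and k outside it, (i - k)(j - k) is a square. Counting squares, such
   a class is a singleton or everything, so all the y_i - y_j with i <> j have
   the same p-adic valuation. Hence u = f (a + h) - f a and
   v = f (a + 2h) - f (a + h), both h times a square, are both zero or have a
   ratio that is a power of 4; as u + v is 2h times a square, parity of the
   2-adic valuation forces u = v. So f is affine on every arithmetic
   progression. *)

Require Import Defs.
From mathcomp Require Import all_boot all_order all_algebra all_field.
From mathcomp Require Import ring lra zify.

Set Implicit Arguments.
Unset Strict Implicit.
Unset Printing Implicit Defensive.

Import GRing.Theory Num.Theory.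
Local Open Scope ring_scope.

(** * Squares in a finite field of odd order *)

(** With [#|F| = 2k + 1], every nonzero [w] satisfies [(w^2)^k = 1], so the nonzero squares are
    among the at most [k] roots of ['X^k - 1]. *)
Lemma card_nonzero_squares (F : finFieldType) : odd #|F| ->
  (#|[set (x ^+ 2)%R | x in [set~ 0%R : F]]|.*2 < #|F|)%N.
Proof.
move=> oddF; set S := [set _ | _ in _].
have F_gt1 : (1 < #|F|)%N := finNzRing_gt1 F.
pose k := #|F|./2.
have cardF : #|F| = k.*2.+1 by rewrite -[LHS]odd_double_half oddF.
have k_gt0 : (0 < k)%N by lia.
suff : (#|S| < size ('X^k - 1 : {poly F})%R)%N by rewrite size_XnsubC // cardF; lia.
rewrite cardE max_poly_roots ?enum_uniq //.
  by rewrite -size_poly_eq0 size_XnsubC.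
apply/allP => x; rewrite mem_enum => /imsetP[w]; rewrite !inE => w_neq0 ->.
rewrite rootE !hornerE -exprM mul2n subr_eq0; apply/eqP/(mulfI w_neq0).
by rewrite mulr1 -exprS -cardF expf_card.
Qed.

(* Both [k |-> (a - k) / (b - k)] from the complement of [C] and
   [c |-> (c - k) (a - k)] from [C] are injective into the nonzero squares,
   which are fewer than half of [F]. *)
Lemma homogeneous_set_full (F : finFieldType) (C : {set F}) (a b : F) :
    odd #|F| -> a != b -> a \in C -> b \in C ->
    (forall c d k, c \in C -> d \in C -> k \notin C ->
       exists w, (c - k) * (d - k) = w ^+ 2) ->
  C = setT.
Proof.
move=> /card_nonzero_squares; set S := [set _ | _ in _] => cardS neq_ab aC bC homC.
apply/eqP; rewrite eqEsubset subsetT /=; apply/subsetP => k _.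
apply/negPn/negP => kC.
have neqC c l : c \in C -> l \notin C -> c - l != 0.
  by move=> cC; apply: contraNneq => /subr0_eq <-.
have sqS c d l : c \in C -> d \in C -> l \notin C -> (c - l) * (d - l) \in S.
  move=> cC dC lC; have [w def_w] := homC _ _ _ cC dC lC.
  apply/imsetP; exists w => //; rewrite !inE; apply/eqP => w0.
  have /eqP := def_w; rewrite w0 expr0n mulf_eq0.
  by rewrite (negPf (neqC _ _ cC lC)) (negPf (neqC _ _ dC lC)).
have leC : (#|C| <= #|S|)%N.
  rewrite -(card_in_imset (f := fun c => (c - k) * (a - k))) => [|c d cC dC /=].
    by apply/subset_leq_card/subsetP => _ /imsetP[c cC ->]; apply: sqS.
  by move/(mulIf (neqC _ _ aC kC))/addIr.
have leC' : (#|~: C| <= #|S|)%N.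
  rewrite -(card_in_imset (f := fun l => (a - l) / (b - l))) => [|l m].
    apply/subset_leq_card/subsetP => _ /imsetP[l + ->]; rewrite inE => lC.
    have bl := neqC _ _ bC lC.
    have /imsetP[w + def_w] := sqS _ _ _ aC bC lC; rewrite !inE => w0.
    apply/imsetP; exists (w / (b - l)).
      by rewrite !inE mulf_neq0 ?invr_neq0.
    by rewrite expr_div_n -def_w; field.
  rewrite !inE => lC mC /= /eqP.
  rewrite eqr_div ?neqC // -subr_eq0.
  have -> : (a - l) * (b - m) - (a - m) * (b - l) = (l - m) * (a - b) by ring.
  by rewrite mulf_eq0 [a - b == 0]subr_eq0 (negPf neq_ab) orbF subr_eq0 => /eqP.
by move: cardS; rewrite -(cardsC C) -addnn ltnNge leq_add.
Qed.

(** * Divisibility of differences by powers of an odd prime *)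

Lemma rat_sqr_int (c : rat) (m : int) : c ^+ 2 = m%:~R -> exists w : int, c = w%:~R.
Proof.
rewrite -[c]divq_num_den; set n := numq c; set d := denq c => eq_m.
have d0 : d%:~R != 0 :> rat by rewrite intr_eq0 denq_neq0.
have eq_n : n ^+ 2 = m * d ^+ 2.
  by apply: (@intr_inj rat); rewrite rmorphXn intrM rmorphXn /= -eq_m expr_div_n
    divfK ?expf_neq0.
apply/intrP/Qint_dvdz.
by rewrite -(@dvdz_pexp2r _ _ 2) // eq_n dvdz_mull.
Qed.

(** Induction on [n]: once all values agree modulo [p^n], the class of [i] modulo [p^(n+1)] also
    contains [j], and [homogeneous_set_full] makes it everything. *)
Lemma square_quotients_dvdz (p n : nat) (y : nat -> int) (i j k l : nat) :
    prime p -> odd p ->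
    (forall a b, (a < p)%N -> (b < p)%N ->
       exists w : int, (a%:Z - b%:Z) * (y a - y b) = w ^+ 2) ->
    (i < p)%N -> (j < p)%N -> (k < p)%N -> (l < p)%N -> i != j ->
  (p%:Z ^+ n %| y i - y j)%Z -> (p%:Z ^+ n %| y k - y l)%Z.
Proof.
move=> p_pr p_odd sq_y ip jp kp lp neq_ij.
have p_gt1 := prime_gt1 p_pr; have pF := pchar_Fp p_pr.
elim: n k l kp lp => [|n IHn] k l kp lp; first by rewrite !expr0 !dvd1z.
move=> dvd_ij; have dvd_all a b : (a < p)%N -> (b < p)%N -> (p%:Z ^+ n %| y a - y b)%Z.
  by move=> ap bp; apply: IHn => //; apply: dvdz_trans dvd_ij; rewrite dvdz_exp2l.
have q0 : p%:Z ^+ n != 0 by rewrite expf_eq0; lia.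
(* The residue of [z a] modulo [p] determines [y a] modulo [p^(n+1)]. *)
pose z a := ((y a - y i) %/ p%:Z ^+ n)%Z.
have def_z a : (a < p)%N -> y a = y i + z a * p%:Z ^+ n.
  by move=> ap; rewrite /z divzK ?dvd_all // addrC subrK.
have dvd_z a b : (a < p)%N -> (b < p)%N ->
    (p%:Z ^+ n.+1 %| y a - y b)%Z = ((z a)%:~R == (z b)%:~R :> 'F_p).
  move=> ap bp; rewrite (def_z a) // (def_z b) // opprD addrACA subrr add0r -mulrBl.
  by rewrite exprS dvdz_mul2r // (dvdz_pcharf pF) rmorphB subr_eq0.
have ltF (a : 'F_p) : (a < p)%N.
  by have := ltn_ord a; rewrite [in X in (_ < X)%N -> _]Fp_cast.
pose C := [set a : 'F_p | (z a)%:~R == 0 :> 'F_p].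
have zi : z i = 0 by rewrite /z subrr div0z.
have valF a : (a < p)%N -> (a%:R : 'F_p) = a :> nat.
  by move=> ap; rewrite val_Fp_nat // modn_small.
suff /setP CT : C = setT.
  have := CT k%:R; have := CT l%:R; rewrite !inE !valF // dvd_z // => /eqP-> /eqP->.
  by rewrite eqxx.
apply: (@homogeneous_set_full _ _ i%:R j%:R).
- by rewrite card_Fp.
- by apply: contra neq_ij => /eqP/(congr1 val)/=; rewrite !valF // => ->.
- by rewrite inE valF // zi.
- by rewrite inE valF // -(rmorph0 (intr : int -> 'F_p)) -zi eq_sym -dvd_z.
move=> a b c; rewrite !inE => /eqP za /eqP zb zc.
have [w def_w] := sq_y a c (ltF a) (ltF c).
have [v def_v] := sq_y b c (ltF b) (ltF c).
(* The square of [w * v] has the factors [y a - y c] and [y b - y c], both divisible by [p^n]. *)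
have /dvdzP[u def_u] : (p%:Z ^+ n %| w * v)%Z.
  rewrite -(@dvdz_pexp2r _ _ 2) // exprMn -def_w -def_v.
  by rewrite mulrACA expr2 dvdz_mull // dvdz_mul // dvd_all.
have eq_u : (a%:Z - c%:Z) * (b%:Z - c%:Z) * (z a - z c) * (z b - z c) = u ^+ 2.
  apply: (mulIf (expf_neq0 2 q0)); rewrite -[RHS]exprMn -def_u exprMn -def_w -def_v.
  rewrite (def_z a) // (def_z b) // (def_z c) //; ring.
(* Modulo [p], [z a] and [z b] vanish, so [eq_u] becomes [(a - c) (b - c) (z c)^2 = u^2], with [z c]
   nonzero because [c] lies outside [C]. *)
exists (u%:~R / (z c)%:~R).
rewrite expr_div_n -rmorphXn -eq_u !rmorphM !rmorphB /= za zb !sub0r -!pmulrn !natr_Zp.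
by field.
Qed.

(** * Comparing valuations of natural numbers *)

(** Only the prime 2 is left to compare. If the 2-adic valuations differed, [T^2 + U^2] would be an
    odd number times a power of 4, and its double would have odd valuation, unlike [W^2]. *)
Lemma eq_of_odd_logn (T U W : nat) :
    (0 < T)%N -> (0 < U)%N -> (2 * (T ^ 2 + U ^ 2) = W ^ 2)%N ->
    (forall p, prime p -> odd p -> logn p T = logn p U) ->
  T = U.
Proof.
have lt2 (A B V : nat) : (0 < A)%N -> (0 < B)%N -> (2 * (A ^ 2 + B ^ 2) = V ^ 2)%N ->
    (logn 2 A < logn 2 B)%N -> False.
  move=> A0 B0 eqV ltAB; have [a' oa defA] := pfactor_coprime (isT : prime 2) A0.
  have [b' ob defB] := pfactor_coprime (isT : prime 2) B0.
  have [d def_d] : exists d, logn 2 B = (logn 2 A + d.+1)%N.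
    by exists (logn 2 B - logn 2 A).-1; lia.
  move: def_d defA defB ltAB; set s := logn 2 A => -> defA defB _.
  have := congr1 (logn 2) eqV; rewrite lognX.
  have -> : (A ^ 2 + B ^ 2 = (a' ^ 2 + (b' * 2 ^ d.+1) ^ 2) * 2 ^ (s * 2))%N.
    by rewrite defA {1}defB expnD !expnMn -!expnM; ring.
  set q := (_ + _)%N.
  have q_odd : odd q by rewrite oddD !oddX oddM oddX /= andbF addbF -coprime2n.
  rewrite !lognM ?muln_gt0 ?expn_gt0 ?(odd_gt0 q_odd) //.
  rewrite pfactorK //.
  rewrite (logn_coprime (m := q)) ?coprime2n //.
  by rewrite logn_prime //=; lia.
move=> T0 U0 eqW eq_odd; apply: eqn_from_log => // p.
have [p_pr|] := boolP (prime p); last by rewrite /logn => /negPf->.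
have [p_odd|] := boolP (odd p); first exact: eq_odd.
have [->|] := even_prime p_pr; last by move=> ->.
move=> _; case: (ltngtP (logn 2 T) (logn 2 U)) => // ltTU; exfalso.
  exact: (lt2 T U W).
by apply: (lt2 U T W); rewrite // addnC.
Qed.

Lemma dvdn_pfactor_eq (p A B : nat) : prime p ->
    (forall n, (p ^ n %| A)%N = (p ^ n %| B)%N) ->
  (A == 0%N) = (B == 0%N) /\ logn p A = logn p B.
Proof.
move=> p_pr; have [->|A0] := posnP A; have [->|B0] := posnP B => // eqAB.
- have := eqAB (logn p B).+1.
  by rewrite dvdn0 pfactor_dvdn // ltnn.
- have := eqAB (logn p A).+1.
  by rewrite dvdn0 pfactor_dvdn // ltnn.
- split=> //.
  by apply/eqP; rewrite eqn_leq -!pfactor_dvdn // -(eqAB (logn p A)) (eqAB (logn p B))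
    !pfactor_dvdnn.
Qed.

(** * Clearing denominators and affinity on progressions *)

Lemma common_denominator (g : nat -> rat) (n : nat) :
  exists2 N : nat, (0 < N)%N & forall i, (i < n)%N -> N%:R * g i \is a Num.int.
Proof.
elim: n => [|n [N N0 IHn]]; first by exists 1%N.
exists (N * `|denq (g n)|)%N; first by rewrite muln_gt0 N0 absz_gt0 denq_neq0.
move=> i; rewrite ltnS leq_eqVlt natrM => /predU1P[->|ltin].
  rewrite -mulrA [_ * g n]mulrC natr_absz gtr0_norm ?denq_gt0 // -numqE.
  by rewrite rpredM ?rpred_nat ?rpred_int.
by rewrite mulrAC rpredM ?IHn ?rpred_nat.
Qed.

Lemma square_quotients_logn (p : nat) (g : nat -> rat) (T U : nat) :
    prime p -> odd p ->
    (forall a b, exists c, (a%:R - b%:R) * (g a - g b) = c ^+ 2) ->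
    g 1%N - g 0%N = T%:R ^+ 2 -> g 2%N - g 1%N = U%:R ^+ 2 ->
  (T == 0%N) = (U == 0%N) /\ logn p T = logn p U.
Proof.
move=> p_pr p_odd sq_g gT gU; have p_gt2 : (2 < p)%N by rewrite odd_prime_gt2.
have [p_gt0 p_gt1] := (prime_gt0 p_pr, prime_gt1 p_pr).
have [N N0 intN] := common_denominator g p.
(* Scaling by [N^2] rather than [N] keeps the products in [sq_g] squares. *)
pose y a := Num.floor (N%:R ^+ 2 * g a).
have def_y a : (a < p)%N -> (y a)%:~R = N%:R ^+ 2 * g a.
  move=> ap; rewrite /y floorK // expr2 -mulrA.
  by rewrite rpredM ?intN ?rpred_nat.
have sq_y a b : (a < p)%N -> (b < p)%N ->
    exists w : int, (a%:Z - b%:Z) * (y a - y b) = w ^+ 2.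
  move=> ap bp; have [c def_c] := sq_g a b.
  have eq_c : ((a%:Z - b%:Z) * (y a - y b))%:~R = (N%:R * c) ^+ 2.
    by rewrite intrM !intrB !def_y // -!pmulrn exprMn -def_c; ring.
  have [w def_w] := rat_sqr_int (esym eq_c).
  by exists w; apply: (@intr_inj rat); rewrite eq_c def_w rmorphXn.
have yT : y 1%N - y 0%N = ((N * T) ^ 2)%N%:Z.
  apply: (@intr_inj rat); rewrite intrB !def_y //.
  by rewrite -mulrBr gT -exprMn -pmulrn natrX natrM.
have yU : y 2%N - y 1%N = ((N * U) ^ 2)%N%:Z.
  apply: (@intr_inj rat); rewrite intrB !def_y //.
  by rewrite -mulrBr gU -exprMn -pmulrn natrX natrM.
have eq_dvd n : (p ^ n %| (N * T) ^ 2)%N = (p ^ n %| (N * U) ^ 2)%N.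
  have dvdE m : (p ^ n %| m)%N = (p%:Z ^+ n %| m%:Z)%Z by rewrite dvdzE abszX.
  rewrite !dvdE -yT -yU.
  (* The index pairs (1, 0) and (2, 1) are compared in both directions; they are in range since
     [p > 2]. *)
  by apply/idP/idP; apply: square_quotients_dvdz.
have [] := dvdn_pfactor_eq p_pr eq_dvd.
rewrite !expn_eq0 !muln_eq0 !andbT (gtn_eqF N0) /= !lognX => eq0 eq_log.
split=> //; have {eq_log} : logn p (N * T) = logn p (N * U) by lia.
have [T0|T0] := posnP T; have [U0|U0] := posnP U; rewrite ?T0 ?U0 ?logn0 //.
- by move: eq0; rewrite T0; lia.
- by move: eq0; rewrite U0; lia.
by rewrite !lognM //; lia.
Qed.

Lemma square_quotients_second_difference (f : rat -> rat) (a h : rat) :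
    (forall x y, exists c, (x - y) * (f x - f y) = c ^+ 2) ->
  f (a + h *+ 2) - f (a + h) = f (a + h) - f a.
Proof.
move=> sq_f; have [->|h0] := eqVneq h 0; first by rewrite mul0rn addr0.
(* This normalises the step to 1; the products get divided by [h^2], so they remain squares. *)
pose g0 n := f (a + n%:R * h) / h.
have sq_g0 i j : exists c, (i%:R - j%:R) * (g0 i - g0 j) = c ^+ 2.
  have [c def_c] := sq_f (a + i%:R * h) (a + j%:R * h).
  exists (c / h); rewrite expr_div_n -def_c /g0; field; exact: h0.
have [t def_t] := sq_g0 1%N 0%N; have [u def_u] := sq_g0 2%N 1%N.
have [v def_v] := sq_g0 2%N 0%N.
pose tu n : rat := if n is 0%N then t else u.
have [M M0 intM] := common_denominator tu 2.
pose g n := M%:R ^+ 2 * g0 n.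
have sq_g i j : exists c, (i%:R - j%:R) * (g i - g j) = c ^+ 2.
  have [c def_c] := sq_g0 i j.
  by exists (M%:R * c); rewrite exprMn -def_c /g; ring.
have abs_int (z : rat) : M%:R * z \is a Num.int ->
    exists n : nat, n%:R ^+ 2 = (M%:R * z) ^+ 2.
  move=> /intrP[m ->]; exists `|m|%N.
  by rewrite natr_absz intr_norm real_normK ?realz.
have [T def_T] := abs_int t (intM 0%N isT).
have [U def_U] := abs_int u (intM 1%N isT).
have gT : g 1%N - g 0%N = T%:R ^+ 2.
  by rewrite def_T exprMn -def_t /g; ring.
have gU : g 2%N - g 1%N = U%:R ^+ 2.
  by rewrite def_U exprMn -def_u /g; ring.
have [W def_W] : exists W : nat, (2 * (T ^ 2 + U ^ 2) = W ^ 2)%N.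
  have eqW : (M%:R * v) ^+ 2 = (2 * (T ^ 2 + U ^ 2))%N%:Z%:~R.
    by rewrite -pmulrn natrM natrD !natrX -gT -gU exprMn -def_v /g; ring.
  have [w def_w] := rat_sqr_int eqW; exists `|w|%N.
  have eq_w : (2 * (T ^ 2 + U ^ 2))%N%:Z = w ^+ 2.
    by apply: (@intr_inj rat); rewrite -eqW def_w rmorphXn.
  by rewrite -abszX -eq_w.
have logTU p : prime p -> odd p -> (T == 0%N) = (U == 0%N) /\ logn p T = logn p U.
  by move=> p_pr p_odd; apply: square_quotients_logn gT gU.
have eqTU : T = U.
  (* The prime 3 serves only to show that [T] and [U] vanish together, which leaves the case where
     both are positive. *)
  have [eq0 _] := logTU 3%N isT isT.
  have [T0|T0] := posnP T; first by apply/eqP; rewrite T0 eq_sym -eq0 T0.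
  have U0 : (0 < U)%N by rewrite lt0n -eq0 -lt0n.
  by apply: eq_of_odd_logn def_W _ => // p p_pr p_odd; have [] := logTU p p_pr p_odd.
have : g 2%N - g 1%N = g 1%N - g 0%N by rewrite gU gT eqTU.
rewrite /g -!mulrBr => /mulfI; rewrite expf_eq0 /= pnatr_eq0 gtn_eqF // => /(_ isT).
rewrite /g0 -!mulrBl => /mulIf; rewrite invr_eq0 => /(_ h0).
by rewrite mul0r addr0 mul1r mulr_natl.
Qed.

(** The progressions [0, x/2, x] and [y, x/2, x - y] share their midpoint, so
    [f (x - y) + f y = f x + f 0]. Thus [F] is additive, hence linear over the rationals. *)
Lemma arithmetic_progressions_affine (f : rat -> rat) :
    (forall a h, f (a + h *+ 2) - f (a + h) = f (a + h) - f a) ->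
  forall x, f x = (f 1 - f 0) * x + f 0.
Proof.
move=> f_ap; pose F x := f x - f 0.
have F_lin : scalable (F : rat^o -> rat^o).
  apply: rat_linear => x y; rewrite /F /=.
  have := f_ap y ((x - y *+ 2) / 2%:R); have := f_ap 0 (x / 2%:R).
  have -> : y + (x - y *+ 2) / 2%:R *+ 2 = x - y by field.
  have -> : y + (x - y *+ 2) / 2%:R = x / 2%:R by field.
  have -> : 0 + x / 2%:R *+ 2 = x by field.
  rewrite add0r; lra.
move=> x; have := F_lin x 1; rewrite /F /GRing.scale /= mulr1 mulrC => <-.
by rewrite subrK.
Qed.

Theorem theorem1p1 (f : rat -> rat) :
  (forall x y : rat, x <> y -> rat_square ((f x - f y) / (x - y)))
  <->
  (exists a b : rat, forall x : rat, f x = a ^+ 2 * x + b).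
Proof.
split=> [sq_f | [a [b f_aff]] x y neq_xy]; last first.
  exists a; rewrite !f_aff; field; rewrite subr_eq0; exact/eqP.
have [a def_a] : rat_square ((f 1 - f 0) / (1 - 0)) by exact: sq_f.
exists a, (f 0) => x; rewrite -def_a subr0 divr1.
apply: arithmetic_progressions_affine => {x} b h.
apply: square_quotients_second_difference => x y.
(* Multiplying the quotient by [(x - y)^2] gives a product form that also covers [x = y]. *)
have [->|neq_xy] := eqVneq x y; first by exists 0; rewrite subrr mul0r expr0n.
have [|c def_c] := sq_f x y; first exact/eqP.
exists ((x - y) * c); rewrite exprMn -def_c; field.
by rewrite subr_eq0.
Qed.
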